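(* Let $S$ be a language with countable symbol set, $X$ a set of formulas of $S$, and $D$ a ruleset of $S$ such that: $R_{\exists\leftarrow}\in D$; $D$ is cut-like; $D$ emulates from $\emptyset$ the ruleset $\{R_0,R_=,R_\leftrightarrow,R_\Rightarrow,R_+,R_{\mathcal R},R_{\exists\rightarrow},R_\downarrow\}$; and $X$ is $D$-consistent. Then there is an interpretation of $S$ with a countable universe satisfying $X$.
   Context: Strings: concatenation is juxtaposition; a symbol is identified with the one-letter string. A language $S$ consists of an integer-valued function $\#$ (arity), an element $\equiv\ \in\operatorname{dom}\#$ with $\#(\equiv)=-2$, and an object $\downarrow\ \notin\operatorname{dom}\#$, with infinitely many literals (symbols $s$ with $\#(s)=0$); the symbol set is $\operatorname{dom}\#\cup\{\downarrow\}$. Terms: smallest set of strings containing each literal $v$ and $s\,t_1\cdots t_n$ whenever $\#(s)=n>0$ and $t_i$ are terms. Formulas: smallest set containing atomic formulas $r\,t_1\cdots t_n$ ($\#(r)=-n<0$), $\downarrow\varphi\psi$ (NOR) and $v\varphi$ ($v$ literal; ''there exists $v$''). $\neg\varphi:=\downarrow\varphi\varphi$. $\psi[v_1/v_2]$ replaces every occurrence of literal $v_1$ by literal $v_2$. Term substitution $\psi[v:=t]$: in atomic formulas replace every occurrence of $v$ in the argument terms by $t$; $(\downarrow\varphi\psi)[v:=t]=\downarrow\varphi[v:=t]\psi[v:=t]$; $(v_1\varphi)[v:=t]=v'(\varphi[v_1/v'])[v:=t]$ with $v'$ a literal $\neq v$ not occurring in $t,\varphi$. An interpretation $i$ with nonempty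 universe $U$ assigns to $s$ with $\#(s)\ge0$ a map $U^{\#(s)}\to U$ and to $s$ with $\#(s)<0$ a map $U^{-\#(s)}\to\{0,1\}$; terms and formulas are evaluated in the usual way ($\equiv t_1t_2$ true iff the values are equal, $\downarrow\varphi\psi$ true iff both false, $v\varphi$ true iff $\varphi$ true under some reassignment of the value of $v$). $i$ satisfies $X$ if all formulas of $X$ evaluate to $1$. A sequent is $(\Gamma,\varphi)$, $\Gamma$ a finite set of formulas, $\varphi$ a formula. A rule maps sets of sequents to sets of sequents; a ruleset is a set of rules. $O_D(\Sigma)=\bigcup_{R\in D}R(\Sigma)$, $O_D^n$ its $n$-th iterate. $X\vdash_D\varphi$ iff some $(\Gamma,\varphi)\in O_D^n(\emptyset)$ with $\Gamma\subseteq X$ finite; $\mathrm{Prov}_D(X)=\{\varphi:X\vdash_D\varphi\}$. $X$ is $D$-consistent if there is no formula $\psi$ with $\psi,\neg\psi\in\mathrm{Prov}_D(X)$, $D$-inconsistent otherwise. $D$ is cut-like if for all $X,\varphi$: $X\cup\{\varphi\}$ $D$-inconsistent implies $X\vdash_D\neg\varphi$. $D_2$ emulates $D_1$ from $\emptyset$ if $\bigcup_{n\ge1}O_{D_1}^n(\emptyset)\subseteq\bigcup_{n\ge1}O_{D_2}^n(\emptyset)$. Rules ($t$'s terms, $\varphi$'s, $\psi$ formulas, $v$'s literals): $R_0(\Sigma)=\{(\{\varphi\},\varphi)\}$; $R_=(\Sigma)=\{(\emptyset,\equiv tt)\}$; $R_\leftrightarrow(\Sigma)=\{(\{\equiv t_1t_2\},\equiv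 t_2t_1)\}$; $R_\Rightarrow(\Sigma)=\{(\{\equiv t_1t_2,\equiv t_2t_3\},\equiv t_1t_3)\}$; $R_+(\Sigma)=\{(\{\equiv t_jt'_j:j\le n\},\equiv st_1\cdots t_n st'_1\cdots t'_n):\#(s)=n>0\}$; $R_{\mathcal R}(\Sigma)=\{(\{\equiv t_jt'_j:j\le n\}\cup\{rt_1\cdots t_n\},rt'_1\cdots t'_n):\#(r)=-n<0\}$; $R_\downarrow(\Sigma)=\{(\{\downarrow\varphi_1\varphi_2,\downarrow\varphi_3\varphi_4\},\downarrow\varphi_2\varphi_3)\}$; $R_{\exists\rightarrow}(\Sigma)=\{(\{\psi[v:=t]\},v\psi)\}$; $R_{\exists\leftarrow}(\Sigma)=\{(\Gamma'\setminus\{\psi[v_1/v_2]\}\cup\{v_1\psi\},\neg{\equiv vv}):(\Gamma'\cup\{\psi[v_1/v_2]\},\neg{\equiv vv})\in\Sigma$, $v_2$ occurring in no element of $\Gamma'\cup\{\psi\}\}$. *)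

(* Defs.v *)
From mathcomp Require Import all_boot all_order all_algebra.
From mathcomp Require Import finmap.
From mathcomp Require Import boolp classical_sets functions cardinality.

Set Implicit Arguments.
Unset Strict Implicit.
Unset Printing Implicit Defensive.

Import Order.TTheory GRing.Theory Num.Theory.
Local Open Scope classical_set_scope.
Local Open Scope ring_scope.

(* [dom S] is the domain of the arity function #. *)
Record language := Language {
  dom : choiceType;
  ar : dom -> int;
  eq_sign : dom;
  ar_eq_sign : ar eq_sign = - 2%:Z;
  literals_infinite : infinite_set [set v | ar v = 0] }.

(* The symbol set is dom # together with one more object, written [None],
   which is the NOR sign. *)
Definition symbol (S : language) : Type := option (dom S).

Definition string (S : language) : Type := seq (symbol S).

Definition nor_sign (S : language) : symbol S := None.

Definition literal (S : language) := {v : dom S | ar v == 0}.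
Definition opsym (S : language) := {s : dom S | 0 <= ar s}.
Definition relsym (S : language) := {r : dom S | ar r < 0}.

Definition arity (S : language) (s : dom S) : nat := `|ar s|%N.

(* The literal is the case of arity 0, where [ts] is empty. *)
Inductive is_term (S : language) : string S -> Prop :=
| IsTerm (s : opsym S) (ts : (arity (val s)).-tuple (string S)) :
    (forall j, is_term (tnth ts j)) -> is_term (Some (val s) :: flatten ts).

Definition term (S : language) := set_type (@is_term S).

Inductive is_formula (S : language) : string S -> Prop :=
| IsAtom (r : relsym S) (ts : (arity (val r)).-tuple (term S)) :
    is_formula (Some (val r) :: flatten [seq val t | t <- ts])
| IsNor (f g : string S) :
    is_formula f -> is_formula g -> is_formula (nor_sign S :: f ++ g)
| IsEx (v : literal S) (f : string S) :
    is_formula f -> is_formula (Some (val v) :: f).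

Definition formula (S : language) := set_type (@is_formula S).

Section Constructors.
Variable S : language.
Implicit Types (v : literal S) (s : opsym S) (r : relsym S).
Implicit Types (t : term S) (f g : formula S).

Definition mkterm (w : string S) (H : is_term w) : term S :=
  exist _ w (mem_set H).

Definition mkformula (w : string S) (H : is_formula w) : formula S :=
  exist _ w (mem_set H).

Lemma termP t : is_term (val t). Proof. exact: set_mem (valP t). Qed.

Lemma formulaP f : is_formula (val f). Proof. exact: set_mem (valP f). Qed.

Lemma app_subproof s (ts : (arity (val s)).-tuple (term S)) :
  is_term (Some (val s) :: flatten [seq val t | t <- ts]).
Proof.
apply: (@IsTerm S s [tuple of map val ts]) => j.
by rewrite tnth_map; exact: termP.
Qed.

Definition app s (ts : (arity (val s)).-tuple (term S)) : term S :=
  mkterm (app_subproof ts).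

Definition atom r (ts : (arity (val r)).-tuple (term S)) : formula S :=
  mkformula (IsAtom ts).

Lemma eqf_subproof t1 t2 : is_formula (Some (eq_sign S) :: val t1 ++ val t2).
Proof.
have rP : ar (eq_sign S) < 0 by rewrite ar_eq_sign.
have sz : size [:: t1; t2] == arity (eq_sign S) by rewrite /arity ar_eq_sign.
have := @IsAtom S (exist _ (eq_sign S) rP) (Tuple sz).
by rewrite /= cats0.
Qed.

Definition eqf t1 t2 : formula S := mkformula (eqf_subproof t1 t2).

Definition norf f g : formula S := mkformula (IsNor (formulaP f) (formulaP g)).

Definition exf v f : formula S := mkformula (IsEx v (formulaP f)).

Definition negf f : formula S := norf f f.

Lemma lit_subproof v : is_term [:: Some (val v)].
Proof.
have vP : 0 <= ar (val v) by rewrite (eqP (valP v)).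
have sz : size ([::] : seq (string S)) == arity (val v).
  by rewrite /arity (eqP (valP v)).
apply: (@IsTerm S (exist _ (val v) vP) (Tuple sz)) => j.
by have := ltn_ord j; rewrite {2}/arity /= (eqP (valP v)).
Qed.

Definition lit v : term S := mkterm (lit_subproof v).

Definition occurs v (w : string S) : bool := Some (val v) \in w.

Definition replace_sym v (x : string S) (w : string S) : string S :=
  flatten [seq (if c == Some (val v) then x else [:: c]) | c <- w].

Lemma replace_sym_flatten v x (ws : seq (string S)) :
  replace_sym v x (flatten ws) = flatten (map (replace_sym v x) ws).
Proof.
rewrite /replace_sym; elim: ws => //= w ws IH.
by rewrite map_cat flatten_cat IH.
Qed.

Lemma term_subst_subproof v t t0 : is_term (replace_sym v (val t) (val t0)).
Proof.
elim: (termP t0) => s ts _ IH.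
rewrite /replace_sym /= -/(replace_sym v (val t) (flatten ts)).
rewrite replace_sym_flatten; case: eqP => [[es]|_].
  have : size ts = 0%N by rewrite size_tuple /arity (es : val s = val v) (eqP (valP v)).
  by move/size0nil => ->; rewrite /= cats0; exact: termP.
apply: (@IsTerm S s [tuple of map (replace_sym v (val t)) ts]) => j.
by rewrite tnth_map.
Qed.

(* [term_subst v t t0]: every occurrence of [v] in [t0] is replaced by [t]. *)
Definition term_subst v t t0 : term S := mkterm (term_subst_subproof v t t0).

Lemma rename_subproof v1 v2 f :
  is_formula (replace_sym v1 [:: Some (val v2)] (val f)).
Proof.
elim: (formulaP f) => [r ts|{}f g _ IHf _ IHg|v {}f _ IHf].
- rewrite /replace_sym /= -/(replace_sym v1 _ (flatten _)).
  rewrite replace_sym_flatten; case: eqP => [[er]|_].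
    by have := valP r; rewrite (er : val r = val v1) (eqP (valP v1)) ltxx.
  have := IsAtom [tuple of map (term_subst v1 (lit v2)) ts].
  by rewrite /= -!map_comp.
- rewrite /replace_sym /= map_cat flatten_cat; exact: IsNor.
- rewrite /replace_sym /= -/(replace_sym v1 _ _).
  by case: eqP => _; exact: IsEx.
Qed.

(* [lit_rename v1 v2 f] is f[v1/v2]; quantified occurrences are replaced too. *)
Definition lit_rename v1 v2 f : formula S := mkformula (rename_subproof v1 v2 f).

(* [fr v t v1 f] is the literal v' used in
   (v1 f)[v:=t] = v' (f[v1/v'])[v:=t]. *)
Definition fresh_choice
    (fr : literal S -> term S -> literal S -> formula S -> literal S) : Prop :=
  forall v t v1 f,
    [/\ fr v t v1 f != v, ~~ occurs (fr v t v1 f) (val t)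
      & ~~ occurs (fr v t v1 f) (val f)].

(* [form_subst fr v t f f'] : f' is f[v:=t]. Strings being uniquely readable,
   f' is determined by the other arguments. *)
Inductive form_subst
    (fr : literal S -> term S -> literal S -> formula S -> literal S)
    (v : literal S) (t : term S) : formula S -> formula S -> Prop :=
| SubstAtom r (ts : (arity (val r)).-tuple (term S)) :
    form_subst fr v t (atom ts) (atom [tuple of map (term_subst v t) ts])
| SubstNor f g f' g' :
    form_subst fr v t f f' -> form_subst fr v t g g' ->
    form_subst fr v t (norf f g) (norf f' g')
| SubstEx v1 f f' :
    form_subst fr v t (lit_rename v1 (fr v t v1 f) f) f' ->
    form_subst fr v t (exf v1 f) (exf (fr v t v1 f) f').

End Constructors.

Record interp (S : language) (U : Type) := Interp {
  op_val : forall s : opsym S, (arity (val s)).-tuple U -> U;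
  rel_val : forall r : relsym S, (arity (val r)).-tuple U -> bool }.

Definition reassign (S : language) (U : Type) (i : interp S U)
    (v : literal S) (u : U) : interp S U :=
  Interp (fun s => if val s == val v then fun=> u else op_val i (s := s))
         (@rel_val S U i).

(* [evalT i t u] and [evalF i f b]: the value of t, resp. f, under i is u,
   resp. b. *)
Inductive evalT (S : language) (U : Type) (i : interp S U) :
    term S -> U -> Prop :=
| EvalApp (s : opsym S) (ts : (arity (val s)).-tuple (term S))
    (us : (arity (val s)).-tuple U) :
    (forall j, evalT i (tnth ts j) (tnth us j)) ->
    evalT i (app ts) (op_val i us).

(* The value [rel_val i] gives to the equality symbol is not used. *)
Inductive evalF (S : language) (U : Type) :
    interp S U -> formula S -> bool -> Prop :=
| EvalEq i t1 t2 u1 u2 :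
    evalT i t1 u1 -> evalT i t2 u2 -> evalF i (eqf t1 t2) `[< u1 = u2 >]
| EvalAtom i (r : relsym S) (ts : (arity (val r)).-tuple (term S))
    (us : (arity (val r)).-tuple U) :
    val r != eq_sign S ->
    (forall j, evalT i (tnth ts j) (tnth us j)) ->
    evalF i (atom ts) (rel_val i us)
| EvalNor i f g a b :
    evalF i f a -> evalF i g b -> evalF i (norf f g) (~~ a && ~~ b)
| EvalEx i v f (b : U -> bool) :
    (forall u, evalF (reassign i v u) f (b u)) ->
    evalF i (exf v f) `[< exists u, b u >].

Definition satisfies (S : language) (U : Type) (i : interp S U)
    (X : set (formula S)) : Prop :=
  forall f, X f -> evalF i f true.

Definition sequent (S : language) : Type := ({fset formula S} * formula S)%type.
Definition rule (S : language) : Type := set (sequent S) -> set (sequent S).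
Definition ruleset (S : language) : Type := set (rule S).

Section Derivation.
Variable S : language.
Implicit Types (D : ruleset S) (X : set (formula S)) (f : formula S).

Definition step D (Sigma : set (sequent S)) : set (sequent S) :=
  \bigcup_(R in D) R Sigma.

Definition derived D (n : nat) : set (sequent S) := iter n (step D) set0.

Definition provable D X f : Prop :=
  exists (n : nat) (Gamma : {fset formula S}),
    derived D n (Gamma, f) /\ [set` Gamma] `<=` X.

Definition Prov D X : set (formula S) := [set f | provable D X f].

Definition consistent D X : Prop :=
  ~ exists f, Prov D X f /\ Prov D X (negf f).

Definition inconsistent D X : Prop := ~ consistent D X.

Definition cut_like D : Prop :=
  forall X f, inconsistent D (X `|` [set f]) -> provable D X (negf f).

Definition emulates D2 D1 : Prop :=
  \bigcup_(n in [set n | (1 <= n)%N]) derived D1 n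
    `<=` \bigcup_(n in [set n | (1 <= n)%N]) derived D2 n.

End Derivation.

Section Rules.
Variable S : language.
Variable fr : literal S -> term S -> literal S -> formula S -> literal S.
Local Open Scope fset_scope.

Definition R_0 : rule S := fun _ =>
  [set q | exists f : formula S, q = ([fset f], f)].

Definition R_eq : rule S := fun _ =>
  [set q | exists t : term S, q = (fset0, eqf t t)].

Definition R_sym : rule S := fun _ =>
  [set q | exists t1 t2 : term S, q = ([fset eqf t1 t2], eqf t2 t1)].

Definition R_trans : rule S := fun _ =>
  [set q | exists t1 t2 t3 : term S,
     q = ([fset eqf t1 t2; eqf t2 t3], eqf t1 t3)].

Definition R_plus : rule S := fun _ =>
  [set q | exists (s : opsym S) (ts ts' : (arity (val s)).-tuple (term S)),
     0 < ar (val s) /\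
     q = ([fset eqf (tnth ts j) (tnth ts' j) | j : 'I_(arity (val s))],
          eqf (app ts) (app ts'))].

Definition R_rel : rule S := fun _ =>
  [set q | exists (r : relsym S) (ts ts' : (arity (val r)).-tuple (term S)),
     q = ([fset eqf (tnth ts j) (tnth ts' j) | j : 'I_(arity (val r))]
            `|` [fset atom ts],
          atom ts')].

Definition R_nor : rule S := fun _ =>
  [set q | exists f1 f2 f3 f4 : formula S,
     q = ([fset norf f1 f2; norf f3 f4], norf f2 f3)].

Definition R_exr : rule S := fun _ =>
  [set q | exists (v : literal S) (t : term S) (f f' : formula S),
     form_subst fr v t f f' /\ q = ([fset f'], exf v f)].

Definition R_exl : rule S := fun Sigma =>
  [set q | exists (Gamma : {fset formula S}) (f : formula S)
                  (v v1 v2 : literal S),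
     [/\ Sigma (Gamma `|` [fset lit_rename v1 v2 f], negf (eqf (lit v) (lit v))),
         (forall g : formula S, g \in Gamma `|` [fset f] -> ~~ occurs v2 (val g))
       & q = ((Gamma `\` [fset lit_rename v1 v2 f]) `|` [fset exf v1 f],
              negf (eqf (lit v) (lit v)))]].

End Rules.

(* Main.v *)
(** By cut-likeness, a maximal [D]-consistent set contains exactly one of [f]
    and [negf f] and everything provable from it; if moreover each of its
    existential formulas has a literal as witness, the terms modulo provable
    equality form a countable model of it. Witnesses can be added one at a time,
    by [R_exl], as long as fresh literals remain. A set [X] may use up all the
    literals, and [D] need not be stable under renaming, so this only shows that
    the finite subsets of [X] are satisfiable. Semantic entailment, on the other
    hand, is stable under renaming and is a calculus of the same kind: the same
    construction, applied to it and to a copy of [X] that leaves infinitely many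
    literals unused, gives compactness together with a countable model. *)
Require Import Defs.
From mathcomp Require Import all_boot all_order all_algebra.
From mathcomp Require Import finmap.
From mathcomp Require Import boolp classical_sets functions cardinality.
Local Open Scope classical_set_scope.

Set Implicit Arguments.
Unset Strict Implicit.
Unset Printing Implicit Defensive.

Import Order.TTheory GRing.Theory Num.Theory.

(** * Unique readability of terms and formulas *)

Section UniqueReadability.
Variable S : language.
Implicit Types (s : opsym S) (r : relsym S) (v : literal S).
Implicit Types (t : term S) (f g : formula S) (w : string S).

Lemma term_ind (P : term S -> Prop) :
  (forall s (ts : (arity (val s)).-tuple (term S)),
     (forall j, P (tnth ts j)) -> P (app ts)) ->
  forall t, P t.
Proof.
move=> H t; move: {-2}(val t) (termP t) (erefl (val t)) => w wP.
elim: wP t => s ts tsP IH t et.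
pose ts' := [tuple mkterm (tsP j) | j < arity (val s)].
have -> : t = app ts'.
  apply: val_inj; rewrite et /=; congr (_ :: flatten _).
  have -> : [seq val t | t <- ts'] = map_tuple val ts' by [].
  by congr val; apply: eq_from_tnth => j; rewrite tnth_map tnth_mktuple.
by apply: H => j; rewrite tnth_mktuple; apply: IH.
Qed.

Lemma formula_ind (P : formula S -> Prop) :
  (forall r (ts : (arity (val r)).-tuple (term S)), P (atom ts)) ->
  (forall f g, P f -> P g -> P (norf f g)) ->
  (forall v f, P f -> P (exf v f)) ->
  forall f, P f.
Proof.
move=> Hatom Hnor Hex f; move: {-2}(val f) (formulaP f) (erefl (val f)) => w wP.
elim: wP f => [r ts|w1 w2 w1P IH1 w2P IH2|v w1 w1P IH1] f ef.
- have -> : f = atom ts by apply: val_inj.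
  exact: Hatom.
- have -> : f = norf (mkformula w1P) (mkformula w2P) by apply: val_inj.
  by apply: Hnor; [exact: IH1|exact: IH2].
- have -> : f = exf v (mkformula w1P) by apply: val_inj.
  by apply: Hex; exact: IH1.
Qed.

(** Cancellation is required only of the terms in [ts], so that the induction hypothesis of
    [term_prefix] can provide it. *)
Lemma flatten_prefix (ts ts' : seq (term S)) w w' :
  (forall t, t \in ts -> forall t' u u', val t ++ u = val t' ++ u' -> t = t') ->
  size ts = size ts' ->
  flatten (map val ts) ++ w = flatten (map val ts') ++ w' -> ts = ts'.
Proof.
elim: ts ts' => [|t ts IH] [|t' ts'] //= H [sz]; rewrite -!catA => e.
have et : t = t' by apply: H e; rewrite mem_head.
move: e; rewrite et => /eqP; rewrite eqseq_cat // eqxx /= => /eqP /IH -> //.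
by move=> x xts; apply: H; rewrite in_cons xts orbT.
Qed.

(** The arbitrary remainders [w] and [w'] say that no term is a proper initial segment of another,
    which is what reading the arguments from left to right requires. *)
Lemma term_prefix t t' w w' : val t ++ w = val t' ++ w' -> t = t'.
Proof.
elim/term_ind: t t' w w' => s ts IH t' w w'.
elim/term_ind: t' => s' ts' _ /=.
move=> [/val_inj es]; case: s' / es ts' => ts' e.
congr app; apply: val_inj; apply: flatten_prefix e; last by rewrite !size_tuple.
by move=> t /tnthP [j ->]; apply: IH.
Qed.

Lemma app_inj s (ts ts' : (arity (val s)).-tuple (term S)) :
  app ts = app ts' -> ts = ts'.
Proof.
move=> /(congr1 val) [] e; apply: val_inj.
apply: (@flatten_prefix _ _ [::] [::]); last by rewrite e.
  by move=> t _; exact: term_prefix.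
by rewrite !size_tuple.
Qed.

Lemma relsym_neq_literal r v : val r <> val v.
Proof. by move=> e; have := valP r; rewrite e (eqP (valP v)) ltxx. Qed.

(** The first symbol reveals the constructor: the NOR sign is [None], a relation symbol has negative
    arity, a literal has arity 0. *)
Lemma formula_prefix f f' w w' : val f ++ w = val f' ++ w' -> f = f'.
Proof.
elim/formula_ind: f f' w w' => [r ts|f g IHf IHg|v f IHf] f' w w';
  elim/formula_ind: f' => [r' ts'|f' g' _ _|v' f' _] //=.
- move=> [/val_inj er]; case: r' / er ts' => ts' e.
  congr atom; apply: val_inj; apply: flatten_prefix e; last by rewrite !size_tuple.
  by move=> t _; exact: term_prefix.
- by move=> [/relsym_neq_literal].
- move=> []; rewrite -!catA => e; have ef := IHf _ _ _ e.
  by move: e; rewrite ef => /eqP; rewrite eqseq_cat // eqxx => /eqP /IHg ->.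
- by move=> [/esym/relsym_neq_literal].
- by move=> [/val_inj ->] /IHf ->.
Qed.

Lemma atom_inj r (ts ts' : (arity (val r)).-tuple (term S)) :
  atom ts = atom ts' -> ts = ts'.
Proof.
move=> /(congr1 val) [] e; apply: val_inj.
apply: (@flatten_prefix _ _ [::] [::]); last by rewrite e.
  by move=> t _; exact: term_prefix.
by rewrite !size_tuple.
Qed.

Lemma norf_inj f g f' g' : norf f g = norf f' g' -> f = f' /\ g = g'.
Proof.
move=> /(congr1 val) [] e; have ef := formula_prefix e; split=> //.
by move: e; rewrite ef => /eqP; rewrite eqseq_cat // eqxx => /eqP /val_inj.
Qed.

Lemma exf_inj v f v' f' : exf v f = exf v' f' -> v = v' /\ f = f'.
Proof. by move=> /(congr1 val) [] /val_inj -> /val_inj ->. Qed.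

Lemma atom_eqf r (ts : (arity (val r)).-tuple (term S)) :
  val r = eq_sign S -> exists t1 t2, atom ts = eqf t1 t2 /\ tval ts = [:: t1; t2].
Proof.
move=> er; have sz : size ts = 2.
  by apply: (etrans (size_tuple ts)); rewrite /arity er ar_eq_sign.
case ets : (tval ts) sz => [|t1 [|t2 [|]]] //= _; exists t1, t2; split=> //.
apply: val_inj => /=; congr (Some _ :: _) => //.
by rewrite ets /= cats0.
Qed.

End UniqueReadability.

(** * Evaluation as total functions on terms and formulas *)

Section Evaluation.
Variables (S : language) (U : Type).
Implicit Types (i : interp S U) (s : opsym S) (r : relsym S) (v : literal S).
Implicit Types (t : term S) (f g : formula S).

Lemma tuple_choice n (P : 'I_n -> U -> Prop) :
  (forall j, exists u, P j u) -> exists us : n.-tuple U, forall j, P j (tnth us j).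
Proof.
move=> /choice [h hP]; exists [tuple h j | j < n] => j.
by rewrite tnth_mktuple.
Qed.

Lemma evalT_total i t : exists u, evalT i t u.
Proof.
elim/term_ind: t => s ts /tuple_choice [us usP].
by exists (op_val i us); constructor.
Qed.

(** The type of [ts] depends on [s], so [t = app ts] is kept as an equation: the head symbols are
    identified first, the argument tuples afterwards. *)
Lemma evalT_inv i t u : evalT i t u ->
  forall s (ts : (arity (val s)).-tuple (term S)), t = app ts ->
  exists us, (forall j, evalT i (tnth ts j) (tnth us j)) /\ u = op_val i us.
Proof.
case=> s' ts' us H s ts e.
have /val_inj es : val s' = val s by case: (congr1 val e).
case: s / es ts e => ts /app_inj <-; by exists us.
Qed.

Lemma evalT_fun i t u u' : evalT i t u -> evalT i t u' -> u = u'.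
Proof.
elim/term_ind: t u u' => s ts IH u u'.
move=> /evalT_inv /(_ _ _ erefl) [us [H ->]] /evalT_inv /(_ _ _ erefl) [us' [H' ->]].
by congr op_val; apply: eq_from_tnth => j; apply: IH (H j) (H' j).
Qed.

Definition valT i t : U := sval (cid (evalT_total i t)).

Lemma valTP i t : evalT i t (valT i t).
Proof. by rewrite /valT; case: cid. Qed.

Lemma valT_app i s (ts : (arity (val s)).-tuple (term S)) :
  valT i (app ts) = op_val i (map_tuple (valT i) ts).
Proof.
apply: evalT_fun (valTP i _) _; constructor=> j.
by rewrite tnth_map; exact: valTP.
Qed.

Lemma evalT_tuple i n (ts : n.-tuple (term S)) (us : n.-tuple U) :
  (forall j, evalT i (tnth ts j) (tnth us j)) -> us = map_tuple (valT i) ts.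
Proof.
move=> H; apply: eq_from_tnth => j; rewrite tnth_map.
exact: evalT_fun (H j) (valTP i _).
Qed.

(* All entries being equal says the right thing for the equality symbol, which
   has exactly two arguments. *)
Definition relV i r (us : (arity (val r)).-tuple U) : bool :=
  if val r == eq_sign S then `[< forall j k, tnth us j = tnth us k >]
  else rel_val i us.

Lemma relV_eqf i r (ts : (arity (val r)).-tuple (term S)) t1 t2 :
  val r = eq_sign S -> tval ts = [:: t1; t2] ->
  relV i (map_tuple (valT i) ts) = `[< valT i t1 = valT i t2 >].
Proof.
move=> er ets; rewrite /relV ifT; last exact/eqP.
apply: asbool_equiv_eq.
have n2 : arity (val r) = 2 by rewrite -(size_tuple ts) ets.
have nthE j : tnth (map_tuple (valT i) ts) j = valT i (nth t1 [:: t1; t2] j).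
  by rewrite tnth_map (tnth_nth t1) ets.
have j0P : 0 < arity (val r) by rewrite n2.
have j1P : 1 < arity (val r) by rewrite n2.
split=> [H|e j k].
  by have := H (Ordinal j0P) (Ordinal j1P); rewrite !nthE.
rewrite !nthE.
have : j < 2 by rewrite -n2.
have : k < 2 by rewrite -n2.
by case: (val j) => [|[|]] //; case: (val k) => [|[|]].
Qed.

(** An inversion principle with explicit equations, whose cases are those of [formula_ind]; [relV]
    merges equations with the other atoms. *)
Inductive evalF_view i f (b : bool) : Prop :=
| ViewAtom r (ts : (arity (val r)).-tuple (term S)) of f = atom ts
    & b = relV i (map_tuple (valT i) ts)
| ViewNor g h a c of f = norf g h & evalF i g a & evalF i h c
    & b = ~~ a && ~~ c
| ViewEx v g (c : U -> bool) of f = exf v g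
    & (forall u, evalF (reassign i v u) g (c u)) & b = `[< exists u, c u >].

Lemma evalFP i f b : evalF i f b -> evalF_view i f b.
Proof.
case=> {i f b} [i t1 t2 u1 u2 H1 H2|i r ts us rN H|i f g a b Hf Hg|i v f b H].
- have rP : (ar (eq_sign S) < 0)%R by rewrite ar_eq_sign.
  have sz : size [:: t1; t2] == arity (eq_sign S) by rewrite /arity ar_eq_sign.
  pose r : relsym S := exist _ (eq_sign S) rP.
  apply: (@ViewAtom _ _ _ r (Tuple sz)).
    by apply: val_inj; rewrite /= cats0.
  rewrite (@relV_eqf i r (Tuple sz) t1 t2) //.
  by rewrite (evalT_fun H1 (valTP i _)) (evalT_fun H2 (valTP i _)).
- apply: (ViewAtom (ts := ts)) => //.
  by rewrite (evalT_tuple H) /relV (negbTE rN).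
- exact: ViewNor Hf Hg erefl.
- exact: ViewEx H erefl.
Qed.

Lemma evalF_atom i r (ts : (arity (val r)).-tuple (term S)) :
  evalF i (atom ts) (relV i (map_tuple (valT i) ts)).
Proof.
have [er|rN] := eqVneq (val r) (eq_sign S).
  have [t1 [t2 [-> /(relV_eqf i er) ->]]] := atom_eqf ts er.
  by constructor; exact: valTP.
rewrite /relV (negbTE rN); constructor=> // j; rewrite tnth_map; exact: valTP.
Qed.

Lemma evalF_total i f : exists b, evalF i f b.
Proof.
elim/formula_ind: f i => [r ts|f g IHf IHg|v f IHf] i.
- by exists (relV i (map_tuple (valT i) ts)); exact: evalF_atom.
- have [[a Ha] [b Hb]] := (IHf i, IHg i).
  by exists (~~ a && ~~ b); constructor.
- have /choice [b Hb] : forall u, exists b, evalF (reassign i v u) f b by [].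
  by exists `[< exists u, b u >]; constructor.
Qed.

Lemma evalF_fun i f b b' : evalF i f b -> evalF i f b' -> b = b'.
Proof.
elim/formula_ind: f i b b' => [r ts|f g IHf IHg|v f IHf] i b b'.
- have H c : evalF i (atom ts) c -> c = relV i (map_tuple (valT i) ts).
    case/evalFP => [r' ts' e ->|? ? ? ? /(congr1 val) //|v g ? e _ _].
      have /val_inj er : val r' = val r by case: (congr1 val e).
      by case: r / er ts e => ts /atom_inj ->.
    by have [/relsym_neq_literal] := congr1 val e.
  by move=> /H -> /H ->.
- have H c : evalF i (norf f g) c ->
      exists a d, [/\ evalF i f a, evalF i g d & c = ~~ a && ~~ d].
    case/evalFP => [r' ts' /(congr1 val) //|f' g' a d e|v f' ? /(congr1 val) //].
    by have [<- <-] := norf_inj e; exists a, d.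
  move=> /H [a [d [Ha Hd ->]]] /H [a' [d' [Ha' Hd' ->]]].
  by rewrite (IHf _ _ _ Ha Ha') (IHg _ _ _ Hd Hd').
- have H c : evalF i (exf v f) c -> exists d : U -> bool,
      (forall u, evalF (reassign i v u) f (d u)) /\ c = `[< exists u, d u >].
    case/evalFP => [r' ts' e _|? ? ? ? /(congr1 val) //|v' f' d e].
      by have [/esym/relsym_neq_literal] := congr1 val e.
    by have [<- <-] := exf_inj e; exists d.
  move=> /H [d [Hd ->]] /H [d' [Hd' ->]]; congr asbool.
  suff -> : d = d' by [].
  by apply/funext => u; exact: IHf (Hd u) (Hd' u).
Qed.

Definition valF i f : bool := sval (cid (evalF_total i f)).

Lemma valFP i f : evalF i f (valF i f).
Proof. by rewrite /valF; case: cid. Qed.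

Lemma valF_atom i r (ts : (arity (val r)).-tuple (term S)) :
  valF i (atom ts) = relV i (map_tuple (valT i) ts).
Proof. exact: evalF_fun (valFP _ _) (evalF_atom _ _). Qed.

Lemma valF_eqf i t1 t2 : valF i (eqf t1 t2) = `[< valT i t1 = valT i t2 >].
Proof. by apply: evalF_fun (valFP _ _) _; constructor; exact: valTP. Qed.

Lemma valF_nor i f g : valF i (norf f g) = ~~ valF i f && ~~ valF i g.
Proof. by apply: evalF_fun (valFP _ _) _; constructor; exact: valFP. Qed.

Lemma valF_neg i f : valF i (negf f) = ~~ valF i f.
Proof. by rewrite valF_nor andbb. Qed.

Lemma valF_ex i v f :
  valF i (exf v f) = `[< exists u, valF (reassign i v u) f >].
Proof. by apply: evalF_fun (valFP _ _) _; constructor=> u; exact: valFP. Qed.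

End Evaluation.

(** * Renaming and substitution of literals, and their semantics *)

Section Renaming.
Variable S : language.
Implicit Types (s : opsym S) (r : relsym S) (v w : literal S).
Implicit Types (t : term S) (f g : formula S) (rho : literal S -> literal S).

Lemma lit_app v : exists s (ts : (arity (val s)).-tuple (term S)),
  lit v = app ts /\ val s = val v.
Proof.
have vP : (0 <= ar (val v))%R by rewrite (eqP (valP v)).
have sz : size ([::] : seq (term S)) == arity (val v).
  by rewrite /arity (eqP (valP v)).
by exists (exist _ (val v) vP), (Tuple sz); split=> //; apply: val_inj.
Qed.

(** Renaming, substitution and reassignment act on the symbols of arity 0 and leave the others
    alone, hence this split. *)
Lemma literal_term_ind (P : term S -> Prop) :
  (forall v, P (lit v)) ->
  (forall s (ts : (arity (val s)).-tuple (term S)), ar (val s) != 0%R ->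
     (forall j, P (tnth ts j)) -> P (app ts)) ->
  forall t, P t.
Proof.
move=> Hlit Happ; elim/term_ind=> s ts IH.
have [es|] := eqVneq (ar (val s)) 0%R; last by move=> sN; exact: Happ.
have -> : app ts = lit (exist (fun d => ar d == 0%R) (val s) (introT eqP es)).
  apply: val_inj => /=; congr (_ :: _).
  have : size ts = 0 by apply: (etrans (size_tuple ts)); rewrite /arity es.
  by move/size0nil => ->.
exact: Hlit.
Qed.

Definition ren_symbol rho (c : symbol S) : symbol S :=
  if c is Some d then
    if (insub d : option (literal S)) is Some v then Some (val (rho v)) else c
  else c.

Lemma relsym_ar_neq0 r : ar (val r) != 0%R.
Proof. by rewrite lt_eqF // (valP r). Qed.

Lemma is_term_ren rho t : is_term (map (ren_symbol rho) (val t)).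
Proof.
elim/literal_term_ind: t => [v|s ts sN IH] /=.
  by rewrite valK; exact: lit_subproof.
rewrite insubN // map_flatten -map_comp.
apply: (@IsTerm S s [tuple of map (map (ren_symbol rho) \o val) ts]) => j.
by rewrite tnth_map; exact: IH.
Qed.

Definition renT rho t : term S := mkterm (is_term_ren rho t).

Lemma renT_lit rho v : renT rho (lit v) = lit (rho v).
Proof. by apply: val_inj; rewrite /= valK. Qed.

Lemma renT_app rho s (ts : (arity (val s)).-tuple (term S)) :
  ar (val s) != 0%R -> renT rho (app ts) = app (map_tuple (renT rho) ts).
Proof.
by move=> sN; apply: val_inj; rewrite /= insubN // map_flatten -!map_comp.
Qed.

Lemma is_formula_ren rho f : is_formula (map (ren_symbol rho) (val f)).
Proof.
elim/formula_ind: f => [r ts|f g IHf IHg|v f IHf] /=.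
- rewrite insubN ?relsym_ar_neq0 // map_flatten -map_comp.
  by have := IsAtom (map_tuple (renT rho) ts); rewrite /= -map_comp.
- by rewrite map_cat; exact: IsNor.
- by rewrite valK; exact: IsEx.
Qed.

Definition renF rho f : formula S := mkformula (is_formula_ren rho f).

Lemma renF_atom rho r (ts : (arity (val r)).-tuple (term S)) :
  renF rho (atom ts) = atom (map_tuple (renT rho) ts).
Proof.
apply: val_inj.
by rewrite /= insubN ?relsym_ar_neq0 // map_flatten -!map_comp.
Qed.

Lemma renF_nor rho f g : renF rho (norf f g) = norf (renF rho f) (renF rho g).
Proof. by apply: val_inj; rewrite /= map_cat. Qed.

Lemma renF_ex rho v f : renF rho (exf v f) = exf (rho v) (renF rho f).
Proof. by apply: val_inj; rewrite /= valK. Qed.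

Lemma ren_symbol_id c : ren_symbol id c = c.
Proof. by case: c => //= d; case: insubP => // v _ ->. Qed.

Lemma renT_id t : renT id t = t.
Proof. by apply: val_inj; rewrite /= (eq_map ren_symbol_id) map_id. Qed.

Lemma renF_id f : renF id f = f.
Proof. by apply: val_inj; rewrite /= (eq_map ren_symbol_id) map_id. Qed.

Lemma lit_renameE v1 v2 f :
  lit_rename v1 v2 f = renF (fun v => if v == v1 then v2 else v) f.
Proof.
apply: val_inj => /=; rewrite /replace_sym.
elim: (val f : seq _) => //= c w ->.
case: c => [d|] //=; case: insubP => [v _ ed|dN]; last first.
  by rewrite ifN //; apply: contraNneq dN => -[->]; exact: (valP v1).
rewrite -ed; have -> : (Some (val v) == Some (val v1)) = (v == v1).
  by rewrite -val_eqE.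
by case: eqP.
Qed.

Lemma occurs_lit v w : occurs v (val (lit w)) = (v == w).
Proof. by rewrite /occurs /= inE -val_eqE. Qed.

Lemma occurs_flatten v (ts : seq (term S)) t c :
  t \in ts -> occurs v (val t) -> occurs v (c :: flatten (map val ts)).
Proof.
move=> tts vt; rewrite /occurs inE; apply/orP; right.
by apply/flattenP; exists (val t) => //; exact: map_f.
Qed.

Lemma term_subst_lit v t w :
  term_subst v t (lit w) = if w == v then t else lit w.
Proof.
apply: val_inj; rewrite /= /replace_sym /= cats0.
have -> : (Some (val w) == Some (val v)) = (w == v) by rewrite -val_eqE.
by case: eqP.
Qed.

Lemma opsym_neq_literal s v : ar (val s) != 0%R -> val s != val v.
Proof. by apply: contraNneq => ->; exact: (valP v). Qed.

Lemma term_subst_app v t s (ts : (arity (val s)).-tuple (term S)) :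
  ar (val s) != 0%R -> term_subst v t (app ts) = app (map_tuple (term_subst v t) ts).
Proof.
move=> sN; apply: val_inj => /=; rewrite /replace_sym /= ifN; last first.
  by apply: contra (opsym_neq_literal v sN) => /eqP [/eqP].
congr (_ :: _); rewrite -/(replace_sym v (val t) (flatten _)).
by rewrite replace_sym_flatten -!map_comp.
Qed.

Variable U : Type.
Implicit Types (i j : interp S U).

Definition agree_nonliteral i j : Prop :=
  (forall s (us : (arity (val s)).-tuple U),
     ar (val s) != 0%R -> op_val i us = op_val j us) /\
  (forall r (us : (arity (val r)).-tuple U), rel_val i us = rel_val j us).

Lemma valT_reassign_lit i v u w :
  valT (reassign i v u) (lit w) = if w == v then u else valT i (lit w).
Proof.
have [s [ts [-> es]]] := lit_app w; rewrite !valT_app /=.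
rewrite (_ : (val s == val v) = (w == v)); last by rewrite es val_eqE.
case: eqP => // _; congr op_val; apply: eq_from_tnth => j.
exfalso; have := leq_ltn_trans (leq0n j) (ltn_ord j).
by rewrite /arity es (eqP (valP w)).
Qed.

Lemma agree_nonliteral_reassign i j v w u u' :
  agree_nonliteral i j -> agree_nonliteral (reassign i v u) (reassign j w u').
Proof.
move=> [Hop Hrel]; split=> // s us sN /=.
by rewrite !ifN ?opsym_neq_literal //; exact: Hop.
Qed.

Lemma agree_nonliteral_reassignl i v u : agree_nonliteral (reassign i v u) i.
Proof. by split=> // s us sN /=; rewrite ifN ?opsym_neq_literal. Qed.

Lemma valT_ren rho i j t :
  agree_nonliteral i j ->
  (forall v, occurs v (val t) -> valT j (lit v) = valT i (lit (rho v))) ->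
  valT i (renT rho t) = valT j t.
Proof.
move=> [Hop _]; elim/literal_term_ind: t => [v|s ts sN IH] H.
  by rewrite renT_lit H // occurs_lit.
rewrite renT_app // !valT_app Hop //; congr op_val.
apply: eq_from_tnth => k; rewrite !tnth_map; apply: IH => v vt.
by apply: H; apply: occurs_flatten vt; exact: mem_tnth.
Qed.

(** Bound literals are renamed along with free ones, so [rho] must not identify two literals of [f]:
    otherwise reassigning [rho v] in [i] would also change the value of some [rho w] with [w]
    different from [v]. *)
Lemma valF_ren rho i j f :
  agree_nonliteral i j ->
  (forall v, occurs v (val f) -> valT j (lit v) = valT i (lit (rho v))) ->
  (forall v w, occurs v (val f) -> occurs w (val f) -> rho v = rho w -> v = w) ->
  valF i (renF rho f) = valF j f.
Proof.
elim/formula_ind: f i j => [r ts|f g IHf IHg|v f IHf] i j ij H inj.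
- rewrite renF_atom !valF_atom; set us := map_tuple _ _; set us' := map_tuple _ _.
  have -> : us = us'.
    apply: eq_from_tnth => k; rewrite !tnth_map; apply: valT_ren => // v vt.
    by apply: H; apply: occurs_flatten vt; exact: mem_tnth.
  by rewrite /relV; case: eqP => // _; case: ij.
- have occl w : occurs w (val f) -> occurs w (val (norf f g)).
    by rewrite /occurs /= inE mem_cat => ->; rewrite orbT.
  have occr w : occurs w (val g) -> occurs w (val (norf f g)).
    by rewrite /occurs /= inE mem_cat => ->; rewrite !orbT.
  rewrite renF_nor !valF_nor (IHf i j) ?(IHg i j) //.
  + by move=> w /occr; exact: H.
  + by move=> w x /occr + /occr; exact: inj.
  + by move=> w /occl; exact: H.
  + by move=> w x /occl + /occl; exact: inj.
- have occv : occurs v (val (exf v f)) by rewrite /occurs /= mem_head.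
  have occf w : occurs w (val f) -> occurs w (val (exf v f)).
    by rewrite /occurs /= inE => ->; rewrite orbT.
  rewrite renF_ex !valF_ex; congr asbool; congr ex; apply/funext => u.
  congr is_true; apply: IHf => [|w wf|w x /occf + /occf]; last exact: inj.
    exact: agree_nonliteral_reassign.
  rewrite !valT_reassign_lit H; last exact: occf.
  have [->|wv] := eqVneq w v; first by rewrite eqxx.
  rewrite ifN //; apply: contraNneq wv => e.
  by rewrite (inj w v (occf _ wf) occv e).
Qed.

Lemma valT_ext i j t :
  agree_nonliteral i j ->
  (forall v, occurs v (val t) -> valT j (lit v) = valT i (lit v)) ->
  valT i t = valT j t.
Proof. by move=> ij H; rewrite -{1}(renT_id t); exact: valT_ren. Qed.

Lemma valF_ext i j f :
  agree_nonliteral i j ->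
  (forall v, occurs v (val f) -> valT j (lit v) = valT i (lit v)) ->
  valF i f = valF j f.
Proof. by move=> ij H; rewrite -{1}(renF_id f); exact: valF_ren. Qed.

Lemma valT_term_subst i v t t0 :
  valT i (term_subst v t t0) = valT (reassign i v (valT i t)) t0.
Proof.
elim/literal_term_ind: t0 => [w|s ts sN IH].
  by rewrite term_subst_lit valT_reassign_lit; case: eqP.
rewrite term_subst_app // !valT_app /= ifN ?opsym_neq_literal //.
by congr op_val; apply: eq_from_tnth => k; rewrite !tnth_map.
Qed.

(** As [v2] does not occur in [f], the map sending [v1] to [v2] is injective on the literals of [f],
    and [valF_ren] applies. *)
Lemma valF_lit_rename i v1 v2 f :
  ~~ occurs v2 (val f) ->
  valF i (lit_rename v1 v2 f) = valF (reassign i v1 (valT i (lit v2))) f.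
Proof.
move=> v2f; have neq v : occurs v (val f) -> v != v2.
  by apply: contraTneq => ->.
rewrite lit_renameE; apply: valF_ren => [|v vf|v w /neq vv2 /neq wv2].
- by case: (agree_nonliteral_reassignl i v1 (valT i (lit v2))) => H1 H2;
    split=> *; rewrite ?H1 ?H2.
- by rewrite valT_reassign_lit; case: eqP.
- case: eqP => [->|_]; case: eqP => [->|_] // e.
  + by rewrite -e eqxx in wv2.
  + by rewrite e eqxx in vv2.
Qed.

(** In the existential case the freshness of [v'] is used three times: off [f], the renaming is
    harmless; off [t], the value of [t] ignores the reassignment of [v']; and distinct from [v], the
    two reassignments do not interfere. *)
Lemma valF_form_subst fr i v t f f' :
  fresh_choice fr -> form_subst fr v t f f' ->
  valF i f' = valF (reassign i v (valT i t)) f.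
Proof.
move=> frP H; elim: H i => [r ts|{}f g {}f' g' _ IHf _ IHg|v1 {}f {}f' _ IH] i.
- rewrite !valF_atom; set us := map_tuple _ _; set us' := map_tuple _ _.
  have -> : us = us'.
    by apply: eq_from_tnth => k; rewrite !tnth_map; exact: valT_term_subst.
  by rewrite /relV.
- by rewrite !valF_nor IHf IHg.
- have [] := frP v t v1 f; set v' := fr v t v1 f => v'v v't v'f.
  rewrite !valF_ex; congr asbool; congr ex; apply/funext => u; congr is_true.
  rewrite IH valF_lit_rename //; apply: valF_ext.
    do 2!apply: agree_nonliteral_reassign.
    exact: agree_nonliteral_reassignl.
  move=> w wf; rewrite !valT_reassign_lit eqxx (negbTE v'v).
  have -> : (w == v') = false by apply: contraTF wf => /eqP ->.
  have -> : valT (reassign i v' u) t = valT i t.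
    apply: valT_ext; first exact: agree_nonliteral_reassignl.
    move=> x xt; rewrite valT_reassign_lit ifN //.
    by apply: contraTneq xt => ->.
  by [].
Qed.

(** The interpretation under which [f] means what [renF rho f] means under [i], for injective
    [rho]. *)
Definition pull rho i : interp S U :=
  Interp (fun s => if (insub (val s) : option (literal S)) is Some v
                   then fun=> valT i (lit (rho v)) else op_val i (s := s))
         (@rel_val S U i).

Lemma agree_nonliteral_pull rho i : agree_nonliteral (pull rho i) i.
Proof. by split=> // s us sN /=; rewrite insubN. Qed.

Lemma valT_pull_lit rho i v : valT (pull rho i) (lit v) = valT i (lit (rho v)).
Proof.
have [s [ts [-> es]]] := lit_app v; rewrite valT_app /=.
by have -> : insub (val s) = Some v by rewrite es valK.
Qed.

End Renaming.

(** * Calculi as sets of sequents *)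

Section Calculus.
Variables (S : language).
Variable fr : literal S -> term S -> literal S -> formula S -> literal S.
Implicit Types (T : set (sequent S)) (X M : set (formula S)).
Implicit Types (s : opsym S) (r : relsym S) (v w : literal S).
Implicit Types (t : term S) (f g : formula S).

Definition provT T X f : Prop :=
  exists Gamma : {fset formula S}, T (Gamma, f) /\ [set` Gamma] `<=` X.

Definition consT T X : Prop := ~ exists f, provT T X f /\ provT T X (negf f).

(** Formulated for a set of sequents rather than a ruleset, so as to cover both what [D] derives and
    semantic entailment. The base rules ignore their argument, so [R set0] is their full output. *)
Record calculus T : Prop := Calculus {
  calc_base : forall R, [set @R_0 S; @R_eq S; @R_sym S; @R_trans S; @R_plus S;
                  @R_rel S; @R_exr S fr; @R_nor S] R -> R set0 `<=` T;
  calc_exl : @R_exl S T `<=` T;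
  calc_cut : forall X f, ~ consT T (X `|` [set f]) -> provT T X (negf f) }.

Definition maximal_consistent T M : Prop :=
  consT T M /\ forall f, ~ M f -> ~ consT T (M `|` [set f]).

(** The condition on [w] makes [valF_lit_rename] applicable in the truth lemma. *)
Definition witnessed M : Prop := forall v f, M (exf v f) ->
  exists w, ~~ occurs w (val f) /\ M (lit_rename v w f).

Lemma provT_mono T X Y f : X `<=` Y -> provT T X f -> provT T Y f.
Proof. by move=> XY [G [TG GX]]; exists G; split=> // x /GX /XY. Qed.

Lemma consT_mono T X Y : X `<=` Y -> consT T Y -> consT T X.
Proof.
move=> XY H [f [Hf Hn]]; apply: H; exists f.
by split; apply: provT_mono XY _.
Qed.

Lemma consT_finite T X :
  (forall G : {fset formula S}, [set` G] `<=` X -> consT T [set` G]) -> consT T X.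
Proof.
move=> H [f [[G [TG GX]] [G' [TG' GX']]]].
apply: (H (G `|` G')%fset) => [x /=|]; first by rewrite inE => /orP[/GX|/GX'].
by exists f; split; [exists G|exists G']; split=> // x /= xG; rewrite inE xG ?orbT.
Qed.

Variable T : set (sequent S).
Hypothesis calcT : calculus T.

Lemma provT_fset X (G : {fset formula S}) f :
  T (G, f) -> [set` G] `<=` X -> provT T X f.
Proof. by exists G. Qed.

Lemma provT_0 X f : X f -> provT T X f.
Proof.
move=> Xf; apply: (@provT_fset _ [fset f]%fset).
  by apply: (calc_base calcT (R := @R_0 S)); [do 7!left|exists f].
by move=> x /=; rewrite inE => /eqP ->.
Qed.

Lemma provT_eq X t : provT T X (eqf t t).
Proof.
apply: (@provT_fset _ fset0).
  by apply: (calc_base calcT (R := @R_eq S)); [do 6!left; right|exists t].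
by move=> x /=; rewrite inE.
Qed.

Lemma provT_sym X t1 t2 : X (eqf t1 t2) -> provT T X (eqf t2 t1).
Proof.
move=> H; apply: (@provT_fset _ [fset eqf t1 t2]%fset).
  by apply: (calc_base calcT (R := @R_sym S)); [do 5!left; right|exists t1, t2].
by move=> x /=; rewrite inE => /eqP ->.
Qed.

Lemma provT_trans X t1 t2 t3 :
  X (eqf t1 t2) -> X (eqf t2 t3) -> provT T X (eqf t1 t3).
Proof.
move=> H1 H2; apply: (@provT_fset _ [fset eqf t1 t2; eqf t2 t3]%fset).
  by apply: (calc_base calcT (R := @R_trans S)); [do 4!left; right|exists t1, t2, t3].
by move=> x /=; rewrite !inE => /orP[/eqP ->|/eqP ->].
Qed.

Lemma provT_plus X s (ts ts' : (arity (val s)).-tuple (term S)) :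
  (forall j, X (eqf (tnth ts j) (tnth ts' j))) ->
  provT T X (eqf (app ts) (app ts')).
Proof.
(* For arity 0 the rule yields nothing, but both tuples are then empty and reflexivity suffices. *)
move=> H; have [sP|sN] := boolP (0 < ar (val s))%R; last first.
  have -> : ts = ts'.
    apply: eq_from_tnth => j; exfalso.
    have := leq_ltn_trans (leq0n j) (ltn_ord j); rewrite /arity absz_gt0.
    by have := valP s; rewrite le_eqVlt (negbTE sN) orbF eq_sym => ->.
  exact: provT_eq.
apply: (@provT_fset _ [fset eqf (tnth ts j) (tnth ts' j) | j : 'I_(arity (val s))]%fset).
  by apply: (calc_base calcT (R := @R_plus S)); [do 3!left; right|exists s, ts, ts'].
by move=> x /= /imfsetP [j _ ->].
Qed.

Lemma provT_rel X r (ts ts' : (arity (val r)).-tuple (term S)) :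
  (forall j, X (eqf (tnth ts j) (tnth ts' j))) -> X (atom ts) ->
  provT T X (atom ts').
Proof.
move=> H Ha; apply: (@provT_fset _
  ([fset eqf (tnth ts j) (tnth ts' j) | j : 'I_(arity (val r))] `|` [fset atom ts])%fset).
  by apply: (calc_base calcT (R := @R_rel S)); [do 2!left; right|exists r, ts, ts'].
by move=> x /=; rewrite inE => /orP[/imfsetP [j _ ->] //|]; rewrite inE => /eqP ->.
Qed.

Lemma provT_exr X v t f f' : form_subst fr v t f f' -> X f' -> provT T X (exf v f).
Proof.
move=> H Xf; apply: (@provT_fset _ [fset f']%fset).
  by apply: (calc_base calcT (R := @R_exr S fr)); [left; right|exists v, t, f, f'].
by move=> x /=; rewrite inE => /eqP ->.
Qed.

Lemma provT_nor X f1 f2 f3 f4 :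
  X (norf f1 f2) -> X (norf f3 f4) -> provT T X (norf f2 f3).
Proof.
move=> H1 H2; apply: (@provT_fset _ [fset norf f1 f2; norf f3 f4]%fset).
  by apply: (calc_base calcT (R := @R_nor S)); [right|exists f1, f2, f3, f4].
by move=> x /=; rewrite !inE => /orP[/eqP ->|/eqP ->].
Qed.

(** An inconsistent set stays inconsistent when [f] is added, so cut-likeness gives explosion for
    negations. *)
Lemma inconsT_prov X f : ~ consT T X -> provT T X (negf f).
Proof.
move=> H; apply: (calc_cut calcT) => H'; apply: H.
by apply: consT_mono H'; exact: subsetUl.
Qed.

(** If the instance were inconsistent with the set, together they would prove the negation of
    [eqf (lit v) (lit v)]; [R_exl] trades the instance for [exf v f], which is already present, and
    reflexivity yields a contradiction. *)
Lemma consT_witness X v w f :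
  consT T (X `|` [set exf v f]) ->
  (forall g, (X `|` [set exf v f]) g -> ~~ occurs w (val g)) ->
  consT T (X `|` [set exf v f] `|` [set lit_rename v w f]).
Proof.
set Y := X `|` _ => Ycons wY; apply: contrapT => /(@inconsT_prov _ (eqf (lit v) (lit v))).
move=> [G [TG GY]]; apply: Ycons; exists (eqf (lit v) (lit v)); split; first exact: provT_eq.
set h := lit_rename v w f.
have [hG|hG] := boolP (h \in G); last first.
  exists G; split=> // x xG; have [//|/= ex] := GY _ xG.
  by case/negP: hG; rewrite /h -ex.
apply: (@provT_fset _ ((G `\ h) `\ h `|` [fset exf v f])%fset).
  (* The instance contains [w] when [v] occurs in [f], so it is first removed from [G]; the
     remaining formulas belong to [Y], where [w] is fresh. *)
  apply: (calc_exl calcT); exists (G `\ h)%fset, f, v, v, w; split=> //.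
    by rewrite fsetUC fsetD1K.
  move=> g; rewrite inE => /orP[|]; rewrite !inE.
    by move=> /andP [gh /GY [/wY //|/= e]]; rewrite e eqxx in gh.
  move=> /eqP ->; apply: contra (wY (exf v f) (or_intror erefl)).
  by rewrite /occurs /= inE => ->; rewrite orbT.
move=> x /=; rewrite !inE => /orP[/and3P [_ xh /GY [//|/= e]]|/eqP ->].
  by rewrite e eqxx in xh.
by right.
Qed.

End Calculus.

(** * The term model of a maximal consistent witnessed set *)

Section TermModel.
Variables (S : language).
Variable fr : literal S -> term S -> literal S -> formula S -> literal S.
Variables (T : set (sequent S)) (M : set (formula S)).
Hypothesis frP : fresh_choice fr.
Hypothesis calcT : calculus fr T.
Hypothesis Mmax : maximal_consistent T M.
Hypothesis Mwit : witnessed M.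
Implicit Types (s : opsym S) (r : relsym S) (v w : literal S).
Implicit Types (t : term S) (f g : formula S).

Lemma max_neg f : ~ M f -> provT T M (negf f).
Proof. by move=> /(proj2 Mmax); exact: (calc_cut calcT). Qed.

Lemma max_closed f : provT T M f -> M f.
Proof.
move=> Mf; apply: contrapT => NMf; apply: (proj1 Mmax).
by exists f; split=> //; exact: max_neg.
Qed.

(** [R_nor] applied to [norf f g] twice swaps its parts; combining both orders gives [negf f] and
    [negf g]. Conversely it combines these two into [norf f g]. *)
Lemma max_nor f g : M (norf f g) <-> ~ M f /\ ~ M g.
Proof.
have nn h : M h -> ~ M (negf h).
  by move=> Mh Mn; apply: (proj1 Mmax); exists h; split; exact: (provT_0 calcT).
split=> [H|[/max_neg/max_closed Hf /max_neg/max_closed Hg]]; last first.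
  exact/max_closed/(provT_nor calcT Hf Hg).
have H' : M (norf g f) by exact/max_closed/(provT_nor calcT H H).
by split=> /nn; apply; apply/max_closed;
  [exact: (provT_nor calcT H' H)|exact: (provT_nor calcT H H')].
Qed.

Definition term_class t : set (term S) := [set t' | M (eqf t t')].

Definition universe : Type := {c : set (term S) | exists t, c = term_class t}.

Definition cls t : universe := exist _ (term_class t) (ex_intro _ t erefl).

Definition repr (u : universe) : term S := sval (cid (proj2_sig u)).

Lemma reprK u : cls (repr u) = u.
Proof.
case: u => c cP; apply: eq_exist => /=.
by rewrite /repr /=; case: cid.
Qed.

Lemma clsP t t' : cls t = cls t' <-> M (eqf t t').
Proof.
split=> [/(congr1 sval) /= e|H].
  suff : term_class t t' by [].
  by rewrite e; exact/max_closed/(provT_eq calcT).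
have H' : M (eqf t' t) by exact/max_closed/(provT_sym calcT).
apply: eq_exist; apply/seteqP; split=> x /= Hx; apply/max_closed.
  exact: (provT_trans calcT H' Hx).
exact: (provT_trans calcT H Hx).
Qed.

Lemma repr_cls t : M (eqf (repr (cls t)) t).
Proof. by apply/clsP; rewrite reprK. Qed.

(** Symbols act on chosen representatives; [R_plus] and [R_rel] make the choice immaterial. *)
Definition term_model : interp S universe :=
  Interp (fun s us => cls (app (map_tuple repr us)))
         (fun r us => `[< M (atom (map_tuple repr us)) >]).

Lemma valT_term_model t : valT term_model t = cls t.
Proof.
elim/term_ind: t => s ts IH; rewrite valT_app /=; apply/clsP/max_closed.
apply: (provT_plus calcT) => j; rewrite !tnth_map IH; exact: repr_cls.
Qed.

Lemma relV_term_model r (ts : (arity (val r)).-tuple (term S)) :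
  relV term_model (map_tuple (valT term_model) ts) = `[< M (atom ts) >].
Proof.
have [er|rN] := eqVneq (val r) (eq_sign S).
  have [t1 [t2 [-> /(relV_eqf term_model er) ->]]] := atom_eqf ts er.
  by rewrite !valT_term_model; apply: asbool_equiv_eq; exact: clsP.
rewrite /relV (negbTE rN) /=; apply: asbool_equiv_eq.
have H j : M (eqf (tnth (map_tuple repr (map_tuple (valT term_model) ts)) j)
                  (tnth ts j)).
  by rewrite !tnth_map valT_term_model; exact: repr_cls.
split=> Ha; apply/max_closed/(provT_rel calcT _ Ha) => // j.
exact/max_closed/(provT_sym calcT).
Qed.

(* The truth lemma recurses from [exf v f] to the substitution instances of
   [f]; these are longer strings, but their connective depth is that of [f]. *)
Inductive depth_le : nat -> formula S -> Prop :=
| DepthAtom n r (ts : (arity (val r)).-tuple (term S)) : depth_le n (atom ts)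
| DepthNor n f g : depth_le n f -> depth_le n g -> depth_le n.+1 (norf f g)
| DepthEx n v f : depth_le n f -> depth_le n.+1 (exf v f).

Lemma depth_le_mono m n f : m <= n -> depth_le m f -> depth_le n f.
Proof.
move=> + H; elim: H n => {m f} [m r ts|m f g _ IHf _ IHg|m v f _ IHf] [|n] // mn;
  constructor; by [exact: IHf|exact: IHg].
Qed.

Lemma depth_le_exists f : exists n, depth_le n f.
Proof.
elim/formula_ind: f => [r ts|f g [m Hm] [n Hn]|v f [n Hn]].
- by exists 0; constructor.
- exists (maxn m n).+1; constructor.
    by apply: depth_le_mono Hm; exact: leq_maxl.
  by apply: depth_le_mono Hn; exact: leq_maxr.
- by exists n.+1; constructor.
Qed.

Lemma depth_le_rename v1 v2 n f : depth_le n f -> depth_le n (lit_rename v1 v2 f).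
Proof.
rewrite lit_renameE; elim=> {n f} [n r ts|n f g _ IHf _ IHg|n v f _ IHf].
- by rewrite renF_atom; constructor.
- by rewrite renF_nor; constructor.
- by rewrite renF_ex; constructor.
Qed.

(** [form_subst] is a relation, so a result has to be constructed. The recursion passes through a
    renamed body, which is not a subformula but has the same depth bound. *)
Lemma form_subst_exists v t n f :
  depth_le n f -> exists f', form_subst fr v t f f' /\ depth_le n f'.
Proof.
elim: n f => [|n IH] f H.
  by case: {-1}_ _ / H (erefl 0) => // m r ts _; eexists; split; constructor.
case: {-1}_ _ / H (erefl n.+1) => [m r ts|m g h Hg Hh|m v1 g Hg] => [_|[em]|[em]].
- by eexists; split; constructor.
- rewrite -em in Hg Hh; have [g' [? ?]] := IH _ Hg; have [h' [? ?]] := IH _ Hh.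
  by exists (norf g' h'); rewrite -em; split; constructor.
- rewrite -em in Hg *.
  have [g' [? ?]] := IH _ (depth_le_rename v1 (fr v t v1 g) Hg).
  by exists (exf (fr v t v1 g) g'); split; constructor.
Qed.

Lemma truth n f : depth_le n f -> valF term_model f = `[< M f >].
Proof.
elim: n f => [|n IH] f H.
  case: {-1}_ _ / H (erefl 0) => // m r ts _.
  by rewrite valF_atom relV_term_model.
case: {-1}_ _ / H (erefl n.+1) => [m r ts|m g h Hg Hh|m v g Hg] => [_|[em]|[em]].
- by rewrite valF_atom relV_term_model.
- rewrite -em in Hg Hh; rewrite valF_nor !IH //; apply/idP/asboolP.
    by move=> /andP [/asboolPn ? /asboolPn ?]; apply/max_nor.
  by move=> /max_nor [? ?]; apply/andP; split; exact/asboolPn.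
- rewrite -em in Hg; rewrite valF_ex; apply: asbool_equiv_eq; split.
    (* Every element is the value of a term, so the substitution lemma turns it into an instance in
       [M], from which [R_exr] gives the existential formula. *)
    move=> [u]; rewrite -{1}(reprK u) -valT_term_model.
    have [g' [Hs Hg']] := form_subst_exists v (repr u) Hg.
    rewrite -(valF_form_subst _ frP Hs) IH // => /asboolP Mg'.
    exact/max_closed/(provT_exr calcT Hs).
  move=> /Mwit [w [wg Mg]]; exists (valT term_model (lit w)).
  rewrite -valF_lit_rename // IH; first exact/asboolP.
  exact: depth_le_rename.
Qed.

Lemma term_model_satisfies : satisfies term_model M.
Proof.
move=> f Mf; have [n Hn] := depth_le_exists f.
have <- : valF term_model f = true by rewrite (truth Hn); exact/asboolP.
exact: valFP.
Qed.

End TermModel.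

(** * Countability and Henkin extensions *)

Lemma countable_inj (A B : Type) (h : A -> B) :
  injective h -> countable [set: B] -> countable [set: A].
Proof.
move=> hinj /countable_injP [k kinj]; apply/countable_injP; exists (k \o h).
by move=> x y _ _ /= e; apply: hinj; apply: kinj e; rewrite in_setT.
Qed.

Lemma countable_seq (A : Type) : countable [set: A] -> countable [set: seq A].
Proof.
move=> /countable_injP [k kinj]; apply/countable_injP.
exists (choice.pickle \o map k) => s s' _ _ /= /(pcan_inj choice.pickleK) /inj_map; apply.
by move=> x y; apply: kinj; rewrite in_setT.
Qed.

Section Henkin.
Variables (S : language).
Variable fr : literal S -> term S -> literal S -> formula S -> literal S.
Implicit Types (X Y M : set (formula S)) (f g : formula S) (v w : literal S).

Definition unused X : set (literal S) :=
  [set v | forall f, X f -> ~~ occurs v (val f)].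

(** A formula is a finite string, so it uses up only finitely many literals. *)
Lemma unused_setU1 X f :
  infinite_set (unused X) -> infinite_set (unused (X `|` [set f])).
Proof.
move=> H; have fin : finite_set [set v | occurs v (val f)].
  apply: (@finite_preimage _ _ [set` (val f : seq _)] (fun v : literal S => Some (val v))).
    by move=> v w _ _ [/val_inj].
  exact: finite_seq.
apply: sub_infinite_set (infinite_setD H fin) => v [vX vf] g [/vX //|->].
exact/negP.
Qed.

Lemma infinite_unused0 : infinite_set (unused set0).
Proof.
move=> H; apply: (literals_infinite (l := S)).
apply: (sub_finite_set _ (finite_image (fun v : literal S => val v) H)).
move=> d d0; exists (exist (fun d => ar d == 0%R) d (introT eqP d0)) => //.
Qed.

Lemma infinite_unused_fset (G : {fset formula S}) : infinite_set (unused [set` G]).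
Proof.
suff H (s : seq (formula S)) : infinite_set (unused [set f | f \in s]) by exact: H.
elim: s => [|f s IH]; first by apply: sub_infinite_set infinite_unused0.
apply: sub_infinite_set (unused_setU1 (f := f) IH) => v H g /=.
by rewrite inE => /orP[/eqP ->|gs]; apply: H; [right|left].
Qed.

Variable T : set (sequent S).
Hypothesis calcT : calculus fr T.

Lemma henkin_step X f : consT T X -> infinite_set (unused X) ->
  exists Y, [/\ consT T Y, infinite_set (unused Y), X `<=` Y &
    consT T (Y `|` [set f]) -> Y f /\ forall v g, f = exf v g ->
      exists w, ~~ occurs w (val g) /\ Y (lit_rename v w g)].
Proof.
move=> Xcons Xinf; have [fcons|fincons] := pselect (consT T (X `|` [set f])); last first.
  by exists X; split.
have Finf := unused_setU1 (f := f) Xinf.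
have [[v [g ef]]|Nex] := pselect (exists v g, f = exf v g); last first.
  exists (X `|` [set f]); split=> // _; split; first by right.
  by move=> v g ef; case: Nex; exists v, g.
have [w wP] := infinite_setN0 Finf.
exists (X `|` [set f] `|` [set lit_rename v w g]); split.
- by rewrite ef; apply: (consT_witness calcT); rewrite -ef.
- exact: unused_setU1.
- by move=> x Xx; left; left.
- move=> _; split; first by left; right.
  move=> v' g'; rewrite ef => /exf_inj [<- <-]; exists w; split; last by right.
  have : ~~ occurs w (val f) by apply: wP; right.
  by rewrite ef; apply: contra; rewrite /occurs /= inE => ->; rewrite orbT.
Qed.

Lemma chain_fset (Y : nat -> set (formula S)) (G : {fset formula S}) :
  (forall m n, m <= n -> Y m `<=` Y n) ->
  [set` G] `<=` \bigcup_n Y n -> exists n, [set` G] `<=` Y n.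
Proof.
move=> Ymono H; have : forall f, f \in (G : seq _) -> exists n, Y n f.
  by move=> f /H [n _ Yf]; exists n.
suff : forall s : seq (formula S), (forall f, f \in s -> exists n, Y n f) ->
    exists n, forall f, f \in s -> Y n f.
  by move=> /[apply] [[n nP]]; exists n.
elim=> [|f s IH] {}H; first by exists 0.
have [m Ym] := H f (mem_head _ _).
have [|n Yn] := IH; first by move=> g gs; apply: H; rewrite inE gs orbT.
exists (maxn m n) => g; rewrite inE => /orP[/eqP ->|/Yn].
  by apply: Ymono Ym; exact: leq_maxl.
by apply: Ymono; exact: leq_maxr.
Qed.

Lemma henkin_extension X : countable [set: formula S] ->
  consT T X -> infinite_set (unused X) ->
  exists M, [/\ X `<=` M, maximal_consistent T M & witnessed M].
Proof.
move=> /countable_injP [k kinj] Xcons Xinf.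
pose good Y := consT T Y /\ infinite_set (unused Y).
pose decides Y f := consT T (Y `|` [set f]) -> Y f /\ forall v g, f = exf v g ->
  exists w, ~~ occurs w (val g) /\ Y (lit_rename v w g).
(* Stage [n] treats the formula with code [n], if there is one. Goodness is a premise under the
   existential, so that choice yields a total step function. *)
have step (p : nat * set (formula S)) : exists Y, good p.2 ->
    [/\ good Y, p.2 `<=` Y & forall f, k f = p.1 -> decides Y f].
  case: p => n Y /=; have [[Ycons Yinf]|] := pselect (good Y); last by exists Y.
  have [[f kf]|Nf] := pselect (exists f, k f = n); last first.
    by exists Y; split=> // f kf; case: Nf; exists f.
  have [Z [Zcons Zinf YZ Zf]] := henkin_step f Ycons Yinf.
  exists Z; split=> // g kg; suff -> : g = f by [].
  by apply: kinj; rewrite ?in_setT // kg.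
have [F FP] := choice step.
pose Y := fix Y n := if n is m.+1 then F (m, Y m) else X.
have Ygood n : good (Y n) by elim: n => [//|n IH]; have [] := FP (n, Y n) IH.
have Ymono m n : m <= n -> Y m `<=` Y n.
  elim: n => [|n IH]; first by rewrite leqn0 => /eqP ->.
  rewrite leq_eqVlt => /orP[/eqP -> //|/IH mn] f /mn.
  by have [_ + _] := FP (n, Y n) (Ygood n); apply.
have Ydec f : decides (Y (k f).+1) f.
  by have [_ _] := FP (k f, Y (k f)) (Ygood _); apply.
have YM n : Y n `<=` \bigcup_n Y n by move=> f Yf; exists n.
exists (\bigcup_n Y n); split; first exact: (YM 0).
  split.
    apply: consT_finite => G /(chain_fset Ymono) [n Gn].
    exact: consT_mono Gn (proj1 (Ygood n)).
  (* A formula consistent with the union is consistent with the stage that decides it, and was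
     therefore added there. *)
  move=> f NMf fcons; apply: NMf; apply: (YM (k f).+1); apply: (proj1 (Ydec f _)).
  by apply: consT_mono fcons; apply: setSU; exact: YM.
(* Adding a formula already in the union keeps it consistent, so the stage deciding [exf v f]
   supplied a witness. *)
move=> v f Mvf; have [] := Ydec (exf v f).
  apply: consT_mono (_ : consT T (\bigcup_n Y n)).
    by move=> x [/YM //|->].
  apply: consT_finite => G /(chain_fset Ymono) [n Gn].
  exact: consT_mono Gn (proj1 (Ygood n)).
by move=> _ /(_ _ _ erefl) [w [wf /YM Mw]]; exists w.
Qed.

Lemma henkin_model X : fresh_choice fr -> countable [set: symbol S] ->
  consT T X -> infinite_set (unused X) ->
  exists (U : Type) (i : interp S U), countable [set: U] /\ satisfies i X.
Proof.
move=> frP Scount Xcons Xinf.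
have strcount := countable_seq Scount.
have fcount : countable [set: formula S] by exact: countable_inj val_inj strcount.
have [M [XM Mmax Mwit]] := henkin_extension fcount Xcons Xinf.
exists (universe M), (term_model M); split.
  (* Representatives embed the universe into the terms, hence into the strings over a countable
     alphabet. *)
  apply: (countable_inj (h := @repr S M)); first exact: can_inj (@reprK S M).
  exact: countable_inj val_inj strcount.
by move=> f /XM; exact: (term_model_satisfies frP calcT).
Qed.

End Henkin.

(** * Compactness with a countable model *)

Section Compactness.
Variables (S : language).
Implicit Types (X : set (formula S)) (f g : formula S) (v w : literal S).

(** Antecedents are finite, so [consT entailment X] amounts to satisfiability of every finite subset
    of [X]. *)
Definition entailment : set (sequent S) :=
  [set q | forall (U : Type) (i : interp S U),
     (forall g, g \in q.1 -> valF i g) -> valF i q.2].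

Lemma calculus_entailment fr : fresh_choice fr -> calculus fr entailment.
Proof.
move=> frP; split.
- move=> R [[[[[[[->|->]|->]|->]|->]|->]|->]|->] q /=.
  + by move=> [f ->] U i /=; apply; rewrite inE.
  + by move=> [t ->] U i _ /=; rewrite valF_eqf; exact/asboolP.
  + move=> [t1 [t2 ->]] U i /= /(_ (eqf t1 t2)).
    by rewrite inE eqxx !valF_eqf => /(_ isT) /asboolP ->; exact/asboolP.
  + move=> [t1 [t2 [t3 ->]]] U i /= H.
    have := H (eqf t1 t2); have := H (eqf t2 t3).
    rewrite !inE !eqxx orbT !valF_eqf => /(_ isT)/asboolP <- /(_ isT)/asboolP ->.
    exact/asboolP.
  + move=> [s [ts [ts' [_ ->]]]] U i /= H; rewrite valF_eqf; apply/asboolP.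
    rewrite !valT_app; congr op_val; apply: eq_from_tnth => j; rewrite !tnth_map.
    have : valF i (eqf (tnth ts j) (tnth ts' j)) by apply: H; exact: in_imfset.
    by rewrite valF_eqf => /asboolP.
  + move=> [r [ts [ts' ->]]] U i /= H.
    have <- : valF i (atom ts) = valF i (atom ts').
      rewrite !valF_atom; congr relV; apply: eq_from_tnth => j; rewrite !tnth_map.
      have : valF i (eqf (tnth ts j) (tnth ts' j)).
        by apply: H; rewrite inE; apply/orP; left; exact: in_imfset.
      by rewrite valF_eqf => /asboolP.
    by apply: H; rewrite !inE eqxx orbT.
  + move=> [v [t [f [f' [Hs ->]]]]] U i /= H; rewrite valF_ex; apply/asboolP.
    exists (valT i t); rewrite -(valF_form_subst i frP Hs).
    by apply: H; rewrite inE.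
  + move=> [f1 [f2 [f3 [f4 ->]]]] U i /= H.
    have := H (norf f1 f2); have := H (norf f3 f4).
    by rewrite !inE !eqxx orbT !valF_nor
      => /(_ isT)/andP [-> _] /(_ isT)/andP [_ ->].
- move=> q [G [f [v [v1 [v2 [HG fresh ->]]]]]] U i /= H.
  have : valF i (exf v1 f) by apply: H; rewrite !inE eqxx orbT.
  rewrite valF_ex => /asboolP [u fu]; exfalso.
  have v2f : ~~ occurs v2 (val f) by apply: fresh; rewrite !inE eqxx orbT.
  (* Giving [v2] the value of a witness makes the instance true and leaves the formulas of [G] other
     than the instance unchanged, so the premise would make [eqf (lit v) (lit v)] false. *)
  pose j := reassign i v2 u.
  have jf : valF j (lit_rename v1 v2 f).
    rewrite valF_lit_rename // valT_reassign_lit eqxx.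
    rewrite (_ : valF _ f = valF (reassign i v1 u) f) //; apply: valF_ext.
      by apply: agree_nonliteral_reassign; exact: agree_nonliteral_reassignl.
    move=> w wf; rewrite !valT_reassign_lit (_ : (w == v2) = false) //.
    by apply: contraNF v2f => /eqP <-.
  have : valF j (negf (eqf (lit v) (lit v))).
    apply: HG => g; rewrite !inE => /orP[gG|/eqP -> //].
    have [-> //|gN] := eqVneq g (lit_rename v1 v2 f).
    have v2g : ~~ occurs v2 (val g) by apply: fresh; rewrite inE gG.
    rewrite (_ : valF j g = valF i g).
      by apply: H; rewrite !inE gN gG.
    apply: valF_ext; first exact: agree_nonliteral_reassignl.
    move=> w wg; rewrite valT_reassign_lit (_ : (w == v2) = false) //.
    by apply: contraNF v2g => /eqP <-.
  by rewrite valF_neg valF_eqf => /asboolPn; apply.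
(* If finite parts of [X] with [f] entail [g] and [negf g], their union without [f] lies in [X] and
   refutes [f]. *)
- move=> X f /contrapT [g [[G [HG GX]] [G' [HG' GX']]]].
  exists ((G `|` G') `\ f)%fset; split; last first.
    move=> h /=; rewrite !inE => /andP [hf /orP[/GX|/GX']] [//|/= e];
      by rewrite e eqxx in hf.
  move=> U i /= H; rewrite valF_neg; apply/negP => fi.
  have HGG' h : h \in (G `|` G')%fset -> valF i h.
    by have [-> //|hf] := eqVneq h f; move=> hG; apply: H; rewrite !inE hf -in_fsetU.
  have : valF i (negf g) by apply: HG' => h hG; apply: HGG'; rewrite inE hG orbT.
  rewrite valF_neg; apply/negP/negPn.
  by apply: HG => h hG; apply: HGG'; rewrite inE hG.
Qed.

Lemma occurs_renF rho w f :
  occurs w (val (renF rho f)) -> exists v, w = rho v.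
Proof.
move=> /mapP [[d|//] _]; rewrite /ren_symbol; case: insubP => [v _ _ [/val_inj e]|dN [e]].
  by exists v.
by case/negP: dN; rewrite -e (valP w).
Qed.

Lemma exists_sparse_renaming : countable [set: symbol S] ->
  exists rho : literal S -> literal S,
    injective rho /\ infinite_set [set w | forall v, w <> rho v].
Proof.
move=> Scount.
have /countable_injP [k kinj] : countable [set: literal S].
  apply: (countable_inj (h := fun v : literal S => Some (val v)) _ Scount).
  by move=> v w [/val_inj].
have /infiniteP /card_leP [b] := @infinite_unused0 S.
pose a (n : nat) : literal S := val (b (exist _ n (mem_set I))).
have ainj m n : a m = a n -> m = n.
  by move=> /val_inj e; have [] := inj (in_setT _) (in_setT _) e.
exists (fun v => a (k v).*2); split.
  by move=> v w /ainj /double_inj; apply: kinj; rewrite in_setT.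
move=> fin; apply: infinite_nat.
apply: sub_finite_set (finite_preimage (f := fun n => a n.*2.+1) _ fin).
  by move=> n _ v /ainj /(congr1 odd); rewrite /= !odd_double.
by move=> m n _ _ /ainj [] /double_inj.
Qed.

Lemma compactness (fr : literal S -> term S -> literal S -> formula S -> literal S)
    X : fresh_choice fr -> countable [set: symbol S] ->
  (forall G : {fset formula S}, [set` G] `<=` X ->
     exists (U : Type) (i : interp S U), satisfies i [set` G]) ->
  exists (U : Type) (i : interp S U), countable [set: U] /\ satisfies i X.
Proof.
move=> frP Scount Xsat.
have [rho [rho_inj rho_inf]] := exists_sparse_renaming Scount.
have calcE := calculus_entailment frP.
have [||U [i [Ucount iX]]] :=
    henkin_model (X := [set renF rho f | f in X]) calcE frP Scount.
- apply: consT_finite => G GX [f [[G1 [HG1 G1G]] [G2 [HG2 G2G]]]].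
  have /choice [h hP] : forall g, exists f, g \in G -> X f /\ renF rho f = g.
    move=> g; have [/GX [f' Xf' <-]|_] := boolP (g \in G); last by exists g.
    by exists f'.
  have [|U [i iG]] := Xsat [fset h g | g in G]%fset.
    by move=> x /= /imfsetP [g /= gG ->]; have [] := hP g gG.
  (* Outside the range of [rho] the left inverse takes an arbitrary value. Pulling back along it
     turns a model of the preimages into a model of [G]. *)
  have [rho' rho'K] : exists rho', cancel rho rho'.
    have /choice [rho' H] : forall w, exists v, (exists v', w = rho v') -> w = rho v.
      by move=> w; have [[v e]|N] := pselect (exists v', w = rho v'); [exists v|exists w].
    by exists rho' => v; apply: rho_inj; rewrite -H //; exists v.
  have jG g : g \in G -> valF (pull rho' i) g.
    move=> gG; have [_ <-] := hP g gG.
    rewrite (_ : valF _ _ = valF i (h g)).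
      by apply: evalF_fun (valFP _ _) (iG _ _); exact: in_imfset.
    apply: valF_ren => [|v _|v w _ _ /rho_inj //]; first exact: agree_nonliteral_pull.
    by rewrite valT_pull_lit rho'K.
  have := HG2 _ (pull rho' i) (fun g gG => jG g (G2G g gG)).
  by rewrite valF_neg (HG1 _ (pull rho' i) (fun g gG => jG g (G1G g gG))).
- apply: sub_infinite_set rho_inf => w wN f [g _ <-].
  by apply/negP => /occurs_renF [v]; exact: wN.
(* The countable model of the renamed copy, pulled back along [rho], is a model of [X] itself. *)
- exists U, (pull rho i); split=> // f Xf.
  have <- : valF (pull rho i) f = true; last exact: valFP.
  rewrite -(valF_ren (rho := rho) (i := i)) => [|||v w _ _ /rho_inj //].
  + by apply: evalF_fun (valFP _ _) (iX _ _); exists f.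
  + have [H1 H2] := agree_nonliteral_pull rho i.
    by split=> *; rewrite ?H1 ?H2.
  + by move=> v _; exact: valT_pull_lit.
Qed.

End Compactness.

(** * Application to the ruleset [D] *)

Lemma derived_calculus (S : language) fr (D : ruleset S) :
  D (@R_exl S) -> cut_like D ->
  emulates D [set @R_0 S; @R_eq S; @R_sym S; @R_trans S; @R_plus S;
                  @R_rel S; @R_exr S fr; @R_nor S] ->
  calculus fr (\bigcup_n derived D n).
Proof.
move=> Dexl Dcut Dem; have provE X f :
    provT (\bigcup_n derived D n) X f <-> provable D X f.
  split=> [[G [[n _ HG] GX]]|[n [G [HG GX]]]]; first by exists n, G.
  by exists G; split=> //; exists n.
split.
(* The output of a base rule on the empty set is in the first iterate of the emulated ruleset. *)
- move=> R HR q qR; have [|n _ Hn] := Dem q; last by exists n.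
  by exists 1 => //; exists R.
- move=> q [G [f [v [v1 [v2 [[n _ HG] fresh e]]]]]]; exists n.+1 => //.
  by exists (@R_exl S) => //; exists G, f, v, v1, v2.
- move=> X f H; apply/provE/Dcut => Hc; apply: H => -[g [/provE H1 /provE H2]].
  by apply: Hc; exists g.
Qed.

Unset Implicit Arguments.

Theorem mainTheorem2 (S : language)
    (fr : literal S -> term S -> literal S -> formula S -> literal S)
    (X : set (formula S)) (D : ruleset S) :
  countable [set: symbol S] ->
  fresh_choice fr ->
  D (@R_exl S) ->
  cut_like D ->
  emulates D [set @R_0 S; @R_eq S; @R_sym S; @R_trans S; @R_plus S;
                  @R_rel S; @R_exr S fr; @R_nor S] ->
  consistent D X ->
  exists (U : Type) (i : interp S U),
    [/\ inhabited U, countable [set: U] & satisfies i X].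
Proof.
move=> Scount frP Dexl Dcut Dem Xcons.
have calcD := derived_calculus Dexl Dcut Dem.
have [|U [i [Ucount iX]]] := @compactness S fr X frP Scount.
  move=> G GX.
  have [||U [i [_ iG]]] := henkin_model (X := [set` G]) calcD frP Scount.
  - move=> [f [[G1 [[m _ H1] G1G]] [G2 [[n _ H2] G2G]]]].
    apply: Xcons; exists f; split.
      by exists m, G1; split=> // g /G1G; exact: GX.
    by exists n, G2; split=> // g /G2G; exact: GX.
  - exact: infinite_unused_fset.
  - by exists U, i.
exists U, i; split=> //.
have [w _] := infinite_setN0 (@infinite_unused0 S).
exact: inhabits (valT i (lit w)).
Qed.
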